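(* Any $n$-vertex 2-connected graph with no two cycles of the same length contains at most $n+\sqrt{n}+o(\sqrt{n})$ edges as $n\to\infty$. That is, for every $\varepsilon>0$ there exists $n_0$ such that for every $n\ge n_0$, every 2-connected graph $G$ on $n$ vertices in which no two distinct cycles have the same length satisfies $|E(G)|\le n+(1+\varepsilon)\sqrt{n}$.
   Context: Graphs are finite and simple. The length of a cycle is its number of edges. *)

(* Defs.v *)
From mathcomp Require Import all_boot all_order all_algebra.
From mathcomp Require Import reals.

Set Implicit Arguments.
Unset Strict Implicit.
Unset Printing Implicit Defensive.

Record sgraph := SGraph {
  vertex :> finType;
  adj : rel vertex;
  adj_sym : symmetric adj;
  adj_irr : irreflexive adj }.

Definition edges (G : sgraph) : {set {set G}} :=
  [set [set x; y] | x in G, y in G & adj x y].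

Definition induced_adj (G : sgraph) (A : {set G}) : rel G :=
  [rel x y | [&& x \in A, y \in A & adj x y]].

Definition connected_on (G : sgraph) (A : {set G}) : Prop :=
  A != set0 /\ {in A &, forall x y, connect (induced_adj A) x y}.

Definition k_connected (k : nat) (G : sgraph) : Prop :=
  k < #|G| /\ forall S : {set G}, #|S| < k -> connected_on (~: S).

Definition cycle_edges (G : sgraph) (c : seq G) : {set {set G}} :=
  [set [set x; next c x] | x in c].

(* A cycle is a subgraph, identified with its edge set, so that rotations and
   reversals of a cyclic vertex sequence give the same cycle.  The bound on
   [size c] matters: for adjacent x and y, [ucycle adj [:: x; y]] holds. *)
Definition is_cycle (G : sgraph) (C : {set {set G}}) : Prop :=
  exists c : seq G, [/\ 2 < size c, ucycle (@adj G) c & C = cycle_edges c].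

Definition cycle_length (G : sgraph) (C : {set {set G}}) : nat := #|C|.

Definition distinct_cycle_lengths (G : sgraph) : Prop :=
  forall C D : {set {set G}}, is_cycle C -> is_cycle D -> C <> D ->
    cycle_length C <> cycle_length D.

(* Main.v *)
Require Import Defs.
From mathcomp Require Import all_boot all_order all_algebra.
From mathcomp Require Import reals.
From mathcomp Require Import ring lra.
Set Implicit Arguments.
Unset Strict Implicit.
Unset Printing Implicit Defensive.
Import Order.TTheory GRing.Theory Num.Theory.

(** The graph enters only through its even edge sets.  They form a vector space
over the field with two elements under symmetric difference, the edge sets of
cycles are its minimal nonzero members (the circuits), its dimension m is at
least e - n + 1, and for a 2-connected graph any two edges share a circuit.
The theorem is an estimate for such connected binary spaces.

Give every edge f a length l f >= 0, put t = 1 / (1 + gam) with gam > 0, and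
let Z be the sum of t ^ l(C) over all circuits C, where l(C) is the sum of the
lengths on C.  The heart of the proof is

  Z >= m^2 / (gam * L + 2) - m,   L = total length           (circuit_sum_lower)

for every connected space.  With all lengths equal to 1 and circuits of
distinct sizes, Z <= t + t^2 + ... = 1 / gam, so that
m^2 <= (gam * e + 2) (1 / gam + m).  Taking gam = (eps / 2) / sqrt n gives
m <= (1 + eps) sqrt n for large n.  This plays the role of the theorem of
Erdos and Turan on Sidon sets, which is the case of a fan: there Z is the sum of
t ^ (x_j - x_i) over the pairs i < j of points of the set, up to the factor t^2.

The lower bound is proved by induction on m and on L.  Let c_f be the
contribution to Z of the circuits through f.  Shortening an edge h of positive
length by 1 adds gam * c_h to Z, and deleting f subtracts c_f.  If deleting f
keeps the space connected, then it lowers m by 1, and the two induction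
hypotheses combine to the claim as soon as 4 c_h <= (c_f + 1)^2; this is the
discrete form of the differential inequality solved by m^2 / (gam * L + 2).  So
one needs a pair (f, h) with that inequality (circuit_sum_at_square).

To find it, delete an edge h of positive length.  The rest falls into blocks
arranged like the blocks on a cycle through h: every circuit through h meets
each of them.  In a smallest such block B, over all choices of h, there is a
removable f, and either some edge of positive length in B is itself removable
(take f = h) or all lengths in B vanish.  In the second case a circuit C
through h that avoids f is the symmetric difference of two circuits that both
contain f and that overlap only inside B, hence at no cost in length; one of
them contains h and the other does not.  As C can be recovered from the two,
c_h <= x (1 + y), where x and y count the circuits through f that do and that
do not contain h.  Then c_f = x + y, and the inequality between arithmetic and
geometric means ends the proof. *)

(** * Circuits of a binary space *)

Section BinarySpace.

Variable E : finType.
Implicit Types (A B C D H K : {set E}) (e f g : E).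

Definition symd A B : {set E} := (A :\: B) :|: (B :\: A).

Lemma in_symd A B e : (e \in symd A B) = (e \in A) (+) (e \in B).
Proof. by rewrite !inE; case: (e \in A); case: (e \in B). Qed.

Lemma symdKl A B : symd A (symd A B) = B.
Proof. by apply/setP=> e; rewrite !in_symd addKb. Qed.

Lemma symdC A B : symd A B = symd B A.
Proof. by apply/setP=> e; rewrite !in_symd addbC. Qed.

Lemma symdD A B : B \subset A -> symd A B = A :\: B.
Proof.
move=> /subsetP sBA; apply/setP=> e; rewrite in_symd in_setD.
by case: (boolP (e \in B)) => [/sBA ->|_]; rewrite ?addbF.
Qed.

Lemma symd_sub A B K : A \subset K -> B \subset K -> symd A B \subset K.
Proof.
move=> /subsetP sA /subsetP sB; apply/subsetP => e; rewrite in_symd.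
by case: (boolP (e \in A)) => [/sA|_ /sB].
Qed.

Lemma symd_eq0 A B : symd A B = set0 -> A = B.
Proof.
move=> AB0; rewrite -[B](symdKl A) AB0.
by apply/setP=> e; rewrite in_symd inE addbF.
Qed.

Variable V : {set {set E}}.

Definition symd_closed := set0 \in V /\ {in V &, forall A B, symd A B \in V}.

(** The circuits of the binary matroid whose cycle space is [V]. *)
Definition circuit C :=
  [&& C \in V, C != set0 & [forall D in V, (D \subset C) ==> (D == set0) || (D == C)]].

Definition circuits H := [set C | circuit C & C \subset H].

(** The connected component of [f] in the restriction of the matroid to [H]; for
graphs, the block that contains [f].  It is empty if [f] lies on no circuit. *)
Definition block H f := \bigcup_(C in circuits H | f \in C) C.

(** Deletion of [e] together with the elements that thereby become bridges, so
that every remaining element still lies on a circuit. *)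
Definition del H e := \bigcup_(C in circuits H | e \notin C) C.

Definition connected_set H :=
  {in H &, forall e f, exists2 C, C \in circuits H & (e \in C) && (f \in C)}.

Definition component H g B := exists2 b, b \in del H g & B = block (del H g) b.

Definition members H := [set D in V | D \subset H].

Hypothesis closedV : symd_closed.
Let V0 := closedV.1.
Let VD := closedV.2.

Lemma circuitP C :
  reflect [/\ C \in V, C != set0 & forall D, D \in V -> D \subset C -> D != set0 -> D = C]
          (circuit C).
Proof.
apply: (iffP and3P) => [[CV C0 /forall_inP minC]|[CV C0 minC]]; split=> //.
  by move=> D DV sDC D0; move: (minC D DV); rewrite sDC (negPf D0) => /eqP.
apply/forall_inP => D DV; apply/implyP => sDC.
by have [//|D0] := eqVneq D set0; rewrite (minC D) ?eqxx.
Qed.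

Lemma in_circuits H C : (C \in circuits H) = circuit C && (C \subset H).
Proof. by rewrite inE. Qed.

Lemma circuitsS H K C : H \subset K -> C \in circuits H -> C \in circuits K.
Proof. by move=> sHK; rewrite !in_circuits => /andP[-> /subset_trans->]. Qed.

(** A smallest member of [V] inside [D] that contains [e] is a circuit: a proper
part of it avoids [e] or has a complement that does, and either way the part
containing [e] would be smaller. *)
Lemma circuit_through D e :
  D \in V -> e \in D -> exists2 C, C \in circuits D & e \in C.
Proof.
move=> DV eD; pose P := [pred C : {set E} | (C \in V) && (e \in C)].
have [|C /minsetP[/andP[CV eC] minC] sCD] := @minset_exists _ P D; first by rewrite /= DV.
exists C => //; rewrite in_circuits sCD andbT; apply/circuitP; split=> //.
  by apply/set0Pn; exists e.
move=> F FV sFC F0; case: (boolP (e \in F)) => eF.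
  by apply: minC => //=; rewrite FV.
have /set0Pn[x xF] := F0.
have := minC (symd C F); rewrite symdD // => CF.
have : C :\: F = C by apply: CF; rewrite ?subsetDl //= -symdD // VD //= in_symd eC (negPf eF).
by move/setP/(_ x); rewrite inE xF (subsetP sFC).
Qed.

(** Binary form of the fan lemma: the circuit [C] and a path through [f] that
joins two points of [C] form a theta graph.  Here [D' :\: C] is that path.  Among
the circuits through [f] that meet [C], inside [C :|: D], one takes [D'] with
[D' :\: C] smallest; anything properly inside [symd C D'] would give a smaller
choice. *)
Lemma theta C D f :
  circuit C -> circuit D -> f \in D -> f \notin C -> C :&: D != set0 ->
  exists D', [/\ circuit D', circuit (symd C D'), f \in D' & D' \subset C :|: D].
Proof.
move=> cC cD fD fC CD0.
pose Q := [pred D' : {set E} |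
  [&& circuit D', f \in D', D' \subset C :|: D & C :&: D' != set0]].
have QD : Q D by rewrite /= cD fD CD0 subsetUr.
case: (arg_minnP (fun D' : {set E} => #|D' :\: C|) QD) => {QD}D' /and4P[cD' fD' sD' CD'] minD'.
exists D'; split=> //.
have [CV _ minC] := circuitP _ cC; have [D'V _ minD] := circuitP _ cD'.
have GV : symd C D' \in V by rewrite VD.
have key Y : circuit Y -> f \in Y -> Y \subset symd C D' -> Y = symd C D'.
  move=> cY fY sY; have [YV Y0 _] := circuitP _ cY.
  have sYC : Y :\: C \subset D' :\: C.
    apply/subsetP => x /setDP[/(subsetP sY)]; rewrite in_symd inE => + xC.
    by rewrite (negPf xC).
  have [YC0|YC] := eqVneq (C :&: Y) set0.
    have sYD : Y \subset D'.
      apply/subsetP => x xY; have := subsetP sYC x; rewrite !inE xY andbT.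
      have : x \notin C.
        by apply/negP => xC; move/setP/(_ x): YC0; rewrite !inE xC xY.
      by move=> -> /(_ isT).
    by rewrite -(minD Y) // YC0 eqxx in CD'.
  have eqYC : Y :\: C = D' :\: C.
    apply/eqP; rewrite eqEcard sYC minD' //= cY fY YC andbT /=.
    apply: subset_trans sY _; apply: symd_sub; rewrite ?subsetUl //.
  have sYD : symd Y D' \subset C.
    apply/subsetP => x; rewrite in_symd; move/setP/(_ x): eqYC; rewrite !inE.
    by case: (x \in C) => //= ->; rewrite addbb.
  have [/symd_eq0 YD|YD] := eqVneq (symd Y D') set0.
    case/set0Pn: CD' => x /setIP[xC xD]; move: (subsetP sY x).
    by rewrite YD in_symd xC xD => /(_ isT).
  rewrite -(minC (symd Y D')) ?VD //.
  by rewrite [symd Y _]symdC [symd (symd _ _) _]symdC symdKl.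
apply/circuitP; split=> //; first by apply/set0Pn; exists f; rewrite in_symd fD' (negPf fC).
move=> F FV sF F0; case: (boolP (f \in F)) => fF.
  have [Y] := circuit_through FV fF; rewrite in_circuits => /andP[cY sYF] fY.
  by apply/eqP; rewrite eqEsubset sF -(key Y) // (subset_trans sYF).
have fX : f \in symd (symd C D') F by rewrite !in_symd (negPf fC) fD' (negPf fF).
have [Y] := circuit_through (VD GV FV) fX; rewrite in_circuits => /andP[cY sYF] fY.
have sYG : Y \subset symd C D' by apply: subset_trans sYF _; rewrite symdD // subsetDl.
have eY := key Y cY fY sYG; case/set0Pn: F0 => x xF.
have xG := subsetP sF x xF.
by move: (subsetP sYF x); rewrite eY => /(_ xG); rewrite in_symd xG xF.
Qed.

Lemma blockP H f e :
  reflect (exists C, [/\ C \in circuits H, f \in C & e \in C]) (e \in block H f).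
Proof.
apply: (iffP bigcupP) => [[C /andP[CH fC] eC]|[C [CH fC eC]]]; first by exists C.
by exists C; rewrite ?CH.
Qed.

Lemma block_sym H e f : (e \in block H f) = (f \in block H e).
Proof. by apply/blockP/blockP => -[C [? ? ?]]; exists C. Qed.

Lemma block_sub H f : block H f \subset H.
Proof. by apply/bigcupsP => C; rewrite in_circuits => /andP[/andP[]]. Qed.

(** Sharing a circuit is transitive: by [theta], each element of a circuit [C] that
meets a circuit [D] through [f] lies on one of two circuits through [f]. *)
Lemma block_circuit H f C e :
  C \in circuits H -> e \in C -> e \in block H f -> C \subset block H f.
Proof.
move=> CH eC /blockP[D [DH fD eD]].
case: (boolP (f \in C)) => fC; first by apply/subsetP=> x xC; apply/blockP; exists C.
move: (CH) (DH); rewrite !in_circuits => /andP[cC sC] /andP[cD sD].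
have CD0 : C :&: D != set0 by apply/set0Pn; exists e; rewrite inE eC.
have [D' [cD' cCD fD' sD']] := theta cC cD fD fC CD0.
have sD'H : D' \subset H by rewrite (subset_trans sD') // subUset sC.
apply/subsetP => x xC; apply/blockP; case: (boolP (x \in D')) => xD.
  by exists D'; rewrite in_circuits cD' sD'H.
exists (symd C D'); rewrite in_circuits cCD symd_sub // !in_symd xC (negPf xD).
by rewrite (negPf fC) fD'.
Qed.

Lemma block_trans H f g e : f \in block H g -> e \in block H f -> e \in block H g.
Proof. by move=> fg /blockP[C [CH fC eC]]; apply: (subsetP (block_circuit CH fC fg)). Qed.

Lemma block_connected H f : connected_set (block H f).
Proof.
move=> d e df ef; have : e \in block H d by rewrite block_sym in df; apply: block_trans df ef.
case/blockP=> C [CH dC eC]; exists C; rewrite ?dC //.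
move: (CH); rewrite !in_circuits => /andP[-> _]; exact: block_circuit df.
Qed.

(** If no circuit crosses between [A] and the rest of [H], then the space restricted
to [H] is a direct sum along [A]. *)
Lemma member_split H A D :
  (forall C, C \in circuits H -> C :&: A != set0 -> C \subset A) ->
  D \in members H -> D :&: A \in V.
Proof.
move=> sepA; have [n] := ubnP #|D|; elim: n D => // n IH D leDn.
rewrite inE => /andP[DV sDH]; have [->|/set0Pn[e eD]] := eqVneq D set0; first by rewrite set0I.
have [C] := circuit_through DV eD; rewrite in_circuits => /andP[cC sCD] eC.
have [CV _ _] := circuitP _ cC.
have CAV : C :&: A \in V.
  have [->//|CA] := eqVneq (C :&: A) set0.
  by rewrite (setIidPl (sepA C _ CA)) // in_circuits cC (subset_trans sCD).
have -> : D :&: A = symd (symd D C :&: A) (C :&: A).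
  apply/setP => x; rewrite inE in_symd !in_setI in_symd.
  by case: (x \in A); rewrite ?andbF // !andbT -addbA addbb addbF.
apply: VD => //; apply: IH; last by rewrite inE VD //= symd_sub // (subset_trans sCD).
rewrite symdD //; rewrite ltnS in leDn; apply: leq_trans leDn; apply: proper_card.
apply/properP; split; first exact: subsetDl.
by exists e; rewrite // inE eC.
Qed.

Lemma delP H g e :
  reflect (exists C, [/\ C \in circuits H, g \notin C & e \in C]) (e \in del H g).
Proof.
apply: (iffP bigcupP) => [[C /andP[CH fC] eC]|[C [CH fC eC]]]; first by exists C.
by exists C; rewrite ?CH.
Qed.

Lemma del_sub H g : del H g \subset H.
Proof. by apply/bigcupsP => C; rewrite in_circuits => /andP[/andP[]]. Qed.

Lemma del_notin H g : g \notin del H g.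
Proof. by apply/delP => -[C [_ /negP]]. Qed.

Lemma circuits_del H g C : (C \in circuits (del H g)) = (C \in circuits H) && (g \notin C).
Proof.
apply/idP/andP => [CH|[CH gC]].
  split; first by apply: circuitsS CH; apply: del_sub.
  move: CH; rewrite in_circuits => /andP[_ /subsetP sC].
  by apply/negP => /sC; apply/negP/del_notin.
move: (CH); rewrite !in_circuits => /andP[-> _] /=.
by apply/subsetP => x xC; apply/delP; exists C.
Qed.

Lemma members_del H g D : D \in members H -> g \notin D -> D \in members (del H g).
Proof.
rewrite !inE => /andP[DV sD] gD; rewrite DV; apply/subsetP => x xD.
have [C] := circuit_through DV xD; rewrite in_circuits => /andP[cC sC] xC.
apply/delP; exists C; rewrite in_circuits cC (subset_trans sC) //; split=> //.
by apply: contra gD => /(subsetP sC).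
Qed.

Lemma block_refl H g b : b \in del H g -> b \in block (del H g) b.
Proof.
by case/delP=> C [CH gC bC]; apply/blockP; exists C; rewrite circuits_del CH gC.
Qed.

(** The components of [del H g] are arranged cyclically with [g].  Some circuit [C0]
through [g] meets [B]; the difference of [C0] and [C] avoids [g], so its part
inside [B] is a member of [V].  If [C] missed [B], that part would be a proper
nonzero piece of the circuit [C0]. *)
Lemma circuit_meets_component H g B C :
  connected_set H -> g \in H -> component H g B -> C \in circuits H -> g \in C ->
  C :&: B != set0.
Proof.
move=> cH gH [b bd ->] CH gC.
have [C0 C0H /andP[gC0 bC0]] := cH g b gH (subsetP (del_sub H g) b bd).
move: (CH) (C0H); rewrite !in_circuits => /andP[cC sC] /andP[cC0 sC0].
have [CV _ _] := circuitP _ cC; have [C0V _ minC0] := circuitP _ cC0.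
have XH : symd C C0 \in members (del H g).
  by apply: members_del; rewrite ?in_symd ?gC ?gC0 // inE VD //= symd_sub.
have XB : symd C C0 :&: block (del H g) b \in V.
  apply: member_split XH => D DH /set0Pn[x /setIP[xD xb]].
  exact: block_circuit xb.
apply/negP => /eqP CB0.
have eqX : symd C C0 :&: block (del H g) b = C0 :&: block (del H g) b.
  apply/setP => x; rewrite !in_setI in_symd; move/setP/(_ x): CB0; rewrite in_setI in_set0.
  by case: (x \in C) => //= ->; rewrite !andbF.
rewrite eqX in XB; have : C0 :&: block (del H g) b = C0.
  apply: minC0 => //; first exact: subsetIl.
  by apply/set0Pn; exists b; rewrite inE bC0 block_refl.
move/setP/(_ g); rewrite in_setI gC0 /= => gb.
by have := del_notin H g; rewrite (subsetP (block_sub _ _) _ gb).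
Qed.

Lemma component_sub H g B : component H g B -> B \subset H.
Proof. by case=> b _ ->; apply: subset_trans (block_sub _ _) (del_sub _ _). Qed.

Lemma component_notin H g B : component H g B -> g \notin B.
Proof.
by case=> b _ ->; apply: contra (del_notin H g); apply: (subsetP (block_sub _ _)).
Qed.

(** Descent on components.  If [e] in [B] is not removable, choose a component [K]
of [del H e] other than the one that contains [g].  It avoids [g], so it lies
inside one component of [del H g].  That component is [B]: any other one avoids
[e], hence would be equal to [K], yet a circuit through [g] that avoids [e] meets
it and so ties it to [g]. *)
Lemma del_connected_or_smaller H g B e :
  connected_set H -> g \in H -> component H g B -> e \in B ->
  connected_set (del H e) \/ exists2 K, component H e K & K \proper B.
Proof.
move=> cH gH compB eB; have [b0 b0d defB] := compB.
have eH : e \in H by apply: (subsetP (component_sub compB)).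
have gB := component_notin compB.
have [Y [YH gY eY]] : exists Y, [/\ Y \in circuits H, g \in Y & e \notin Y].
  move: (eB); rewrite defB => /blockP[D [DB b0D eD]].
  move: DB; rewrite circuits_del => /andP[DH gD].
  have [C CH /andP[gC eC]] := cH g e gH eH.
  move: CH DH; rewrite !in_circuits => /andP[/circuitP[CV _ _] sC] /andP[/circuitP[DV _ _] sD].
  have gX : g \in symd C D by rewrite in_symd gC (negPf gD).
  have [Y] := circuit_through (VD CV DV) gX; rewrite in_circuits => /andP[cY sY] gY.
  exists Y; rewrite in_circuits cY (subset_trans sY) ?symd_sub //; split=> //.
  by apply/negP => /(subsetP sY); rewrite in_symd eC eD.
have Yd : Y \in circuits (del H e) by rewrite circuits_del YH.
have [sub|/subsetPn[b bd bg]] := boolP (del H e \subset block (del H e) g).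
  left; have <- : block (del H e) g = del H e by apply/eqP; rewrite eqEsubset block_sub.
  exact: block_connected.
right; pose K := block (del H e) b.
have gK : g \notin K by rewrite block_sym.
have avoid C : C \in circuits K -> C \in circuits (del H g).
  move=> CK; rewrite circuits_del (circuitsS _ CK) //=.
    by move: CK; rewrite in_circuits => /andP[_ sC]; apply: contra gK; apply: (subsetP sC).
  exact: subset_trans (block_sub _ _) (del_sub _ _).
have Kd : component H e K by exists b.
have bK : b \in K := block_refl bd.
have sKB' : K \subset block (del H g) b.
  apply/subsetP => x xK; have [C CK /andP[xC bC]] := block_connected xK bK.
  by apply/blockP; exists C; rewrite avoid.
exists K => //; apply/properP; split; last first.
  by exists e => //; apply: component_notin Kd.
have [bB|bB] := boolP (b \in B).
  by apply/subsetP=> x /(subsetP sKB'); rewrite defB; apply: block_trans; rewrite -defB.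
have bdg : b \in del H g.
  by apply: (subsetP (block_sub _ b)); apply: (subsetP sKB').
have eB' : e \notin block (del H g) b.
  apply: contra bB; rewrite block_sym defB; apply: block_trans; by rewrite -defB.
have /set0Pn[y /setIP[yY yB']] :=
  circuit_meets_component cH gH (ex_intro2 _ _ b bdg erefl) YH gY.
have yK : y \in K.
  have [C CB /andP[yC bC]] := block_connected yB' (block_refl bdg).
  apply/blockP; exists C; split=> //; rewrite circuits_del; apply/andP; split.
    by apply: circuitsS CB; apply: subset_trans (block_sub _ _) (del_sub _ _).
  by move: CB; rewrite in_circuits => /andP[_ sC]; apply: contra eB'; apply: (subsetP sC).
by case/negP: gK; apply: (subsetP (block_circuit Yd yY yK)).
Qed.

Lemma component_in H g B : component H g B -> exists2 b, b \in B & b \in H.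
Proof.
case=> b bd ->; exists b; first exact: block_refl.
exact: (subsetP (del_sub H g)).
Qed.

Lemma removable_in_component H g B :
  connected_set H -> g \in H -> component H g B ->
  exists2 f, f \in B & connected_set (del H f).
Proof.
move=> cH; have [n] := ubnP #|B|; elim: n g B => // n IH g B leB gH compB.
have [e eB eH] := component_in compB.
have [|[K compK ltK]] := del_connected_or_smaller cH gH compB eB; first by exists e.
have [|f fK cf] := IH e K _ eH compK.
  by rewrite ltnS in leB; apply: leq_trans leB; apply: proper_card.
by exists f => //; apply: (subsetP (proper_sub ltK)).
Qed.

(** The marked elements will be those of positive length.  Descending to a smallest
component of some [del H h] with [h] marked produces either a removable marked
element or a component without marked elements, in which some removable [f] is
found by [removable_in_component]. *)
Lemma removable_near_marked (W : pred E) H g B :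
  connected_set H -> g \in H -> W g -> component H g B ->
  exists f h, [/\ f \in H, h \in H, W h, connected_set (del H f) &
    f = h \/ exists K, [/\ component H h K, f \in K & {in K, forall x, ~~ W x}]].
Proof.
move=> cH; have [n] := ubnP #|B|; elim: n g B => // n IH g B leB gH Wg compB.
have [/exists_inP[e eB We]|/exists_inPn noW] := boolP [exists e in B, W e].
  have eH := subsetP (component_sub compB) e eB.
  have [ce|[K compK ltK]] := del_connected_or_smaller cH gH compB eB.
    by exists e, e; split=> //; left.
  apply: (IH e K) => //.
  by rewrite ltnS in leB; apply: leq_trans leB; apply: proper_card.
have [f fB cf] := removable_in_component cH gH compB.
exists f, g; split=> //; first exact: (subsetP (component_sub compB)).
by right; exists B.
Qed.

End BinarySpace.

(** * Weighted sums over circuits *)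

Section Weights.

Variables (E : finType) (V : {set {set E}}).
Hypothesis closedV : symd_closed V.
Implicit Types (C D H K B : {set E}) (e f g : E).

(** The members that avoid [f] have index at most 2; adding a fixed circuit through
[f] maps the other coset into them. *)
Lemma members_half H f :
  connected_set V H -> f \in H -> #|members V H| <= 2 * #|members V (del V H f)|.
Proof.
move=> cH fH; have [V0 VD] := closedV.
have [C0 C0H /andP[fC0 _]] := cH f f fH fH.
move: C0H; rewrite in_circuits => /andP[/circuitP[C0V _ _] sC0].
rewrite -(cardsID [set D : {set E} | f \notin D]) mul2n -addnn leq_add //.
  apply/subset_leq_card/subsetP => D; rewrite inE => /andP[DH]; rewrite inE.
  exact: members_del.
rewrite -(card_imset _ (can_inj (symdKl C0))) subset_leq_card //.
apply/subsetP => _ /imsetP[D + ->]; rewrite !in_setD in_set negbK inE => /and3P[fD DV sD].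
by apply: members_del; rewrite ?in_symd ?fC0 ?fD // inE VD //= symd_sub.
Qed.

Lemma del_neq0 H f :
  connected_set V H -> f \in H -> 4 <= #|members V H| -> exists b, b \in del V H f.
Proof.
move=> cH fH le4; apply/set0Pn; apply: contraL le4 => /eqP d0.
rewrite -ltnNge; apply: leq_ltn_trans (members_half cH fH) _; rewrite d0.
suff : #|members V set0| <= 1 by case: #|_| => [|[]].
apply: leq_trans (_ : #|[set set0 : {set E}]| <= 1); last by rewrite cards1.
by apply/subset_leq_card/subsetP => D; rewrite !inE subset0 => /andP[].
Qed.

Lemma exists_in_members H : 1 < #|members V H| -> exists f, f \in H.
Proof.
move=> lt1; apply/set0Pn; apply: contraL lt1 => /eqP ->; rewrite -leqNgt.
apply: leq_trans (_ : #|[set set0 : {set E}]| <= 1); last by rewrite cards1.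
by apply/subset_leq_card/subsetP => D; rewrite !inE subset0 => /andP[].
Qed.

(** The dimension enters only as the inequality [2 ^ m <= #|members V H|].  When all
lengths vanish, this bound is what replaces the comparison of two edges.  For the
induction, a removable [e] is taken in a component of [del H f], so that [f]
survives its deletion; connectedness then yields one more circuit, through both
[e] and [f]. *)
Lemma circuits_through_geq m H f :
  connected_set V H -> 2 ^ m <= #|members V H| -> f \in H ->
  m <= #|[set C in circuits V H | f \in C]|.
Proof.
elim: m H => // -[_ H cH _ fH|m IH H cH le2 fH].
  have [C CH /andP[fC _]] := cH f f fH fH.
  by apply/card_gt0P; exists C; rewrite in_set CH.
have [|b bd] := @del_neq0 H f cH fH.
  by apply: leq_trans le2; rewrite -[4]/(2 ^ 2) leq_exp2l.
have compB : component V H f (block V (del V H f) b) by exists b.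
have [e eB ce] := removable_in_component closedV cH fH compB.
have eH : e \in H by apply: (subsetP (component_sub compB)).
have fe : f \in del V H e.
  have [D [DB bD eD]] := blockP _ _ _ _ eB.
  move: DB; rewrite circuits_del // => /andP[DH fD].
  have [C CH /andP[fC eC]] := cH f e fH eH.
  move: CH DH; rewrite !in_circuits => /andP[/circuitP[CV _ _] sC] /andP[/circuitP[DV _ _] sD].
  have CDH : symd C D \in members V H by rewrite inE closedV.2 //= symd_sub.
  have eX : e \notin symd C D by rewrite in_symd eC eD.
  have := members_del closedV CDH eX; rewrite inE => /andP[_ /subsetP]; apply.
  by rewrite in_symd fC (negPf fD).
have le2' : 2 ^ m.+1 <= #|members V (del V H e)|.
  by rewrite -(leq_pmul2l (ltn0Sn 1)) -expnS (leq_trans le2) // members_half.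
have [C CH /andP[fC eC]] := cH f e fH eH.
apply: leq_ltn_trans (IH _ ce le2' fe) _; apply: proper_card; apply/properP; split.
  apply/subsetP=> D; rewrite in_set circuits_del => /andP[/andP[DH _] fD].
  by rewrite in_set DH.
by exists C; rewrite in_set ?circuits_del ?CH ?fC ?eC.
Qed.

Local Open Scope ring_scope.

Variable R : realFieldType.

Definition weight (t : R) (l : E -> nat) C : R := t ^+ (\sum_(e in C) l e).

Definition circuit_sum t l H : R := \sum_(C in circuits V H) weight t l C.

Definition circuit_sum_at t l H f : R := \sum_(C in circuits V H | f \in C) weight t l C.

Lemma weight_ge0 t l C : 0 <= t -> 0 <= weight t l C.
Proof. exact: exprn_ge0. Qed.

Lemma circuit_sum_ge0 t l H : 0 <= t -> 0 <= circuit_sum t l H.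
Proof. by move=> t0; apply: sumr_ge0 => C _; apply: weight_ge0. Qed.

Lemma circuit_sum_at_ge0 t l H f : 0 <= t -> 0 <= circuit_sum_at t l H f.
Proof. by move=> t0; apply: sumr_ge0 => C _; apply: weight_ge0. Qed.

Lemma circuit_sum_del t l H f :
  circuit_sum t l H = circuit_sum_at t l H f + circuit_sum t l (del V H f).
Proof.
rewrite /circuit_sum (bigID (fun C => f \in C)) /=; congr (_ + _).
by apply: eq_bigl => C; rewrite circuits_del.
Qed.

Lemma sum_symd (l : E -> nat) A B : {in A :&: B, forall e, l e = 0%N} ->
  (\sum_(e in symd A B) l e = \sum_(e in A) l e + \sum_(e in B) l e)%N.
Proof.
move=> l0; rewrite !(big_mkcond (fun e => e \in _)) -big_split /=.
apply: eq_bigr => e _; rewrite in_symd; move: (l0 e); rewrite inE.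
case: (e \in A); case: (e \in B) => //=; last by rewrite addn0.
by move=> ->.
Qed.

(** The map behind the bound sends a circuit [C] through [g] that avoids [f] to the
two circuits of a theta graph formed by [C] and a path through [f] inside [B].
Their symmetric difference is [C], so the map is injective, and the lengths
vanish on their intersection, so the weights multiply to that of [C]. *)
Lemma circuit_sum_at_product t l H B g f :
  0 <= t -> connected_set V H -> g \in H -> component V H g B -> f \in B ->
  {in B, forall x, l x = 0%N} ->
  circuit_sum_at t l H g <=
    (\sum_(C in circuits V H | (f \in C) && (g \in C)) weight t l C) *
    (1 + \sum_(C in circuits V H | (f \in C) && (g \notin C)) weight t l C).
Proof.
move=> t0 cH gH compB fB l0; have [V0 VD] := closedV; have gB := component_notin compB.
have sBH := component_sub compB.
rewrite mulrDr mulr1 /circuit_sum_at (bigID (fun C => f \in C)) /=; apply: lerD.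
  rewrite le_eqVlt; apply/orP; left; apply/eqP.
  by apply: eq_bigl => C; rewrite -andbA [(g \in C) && _]andbC.
rewrite big_distrlr /= pair_big /=.
(* Only the pairs whose symmetric difference is one of the circuits to be
   counted are kept, grouped by that circuit. *)
pose P (p : {set E} * {set E}) :=
  (p.1 \in circuits V H) && ((f \in p.1) && (g \in p.1)) &&
  ((p.2 \in circuits V H) && ((f \in p.2) && (g \notin p.2))).
pose Q C := (C \in circuits V H) && (g \in C) && (f \notin C).
rewrite -[leRHS]/(\sum_(p | P p) weight t l p.1 * weight t l p.2).
rewrite [leRHS](bigID (fun p => Q (symd p.1 p.2))) /=.
apply: ler_wpDr; first by apply: sumr_ge0 => p _; rewrite mulr_ge0 ?weight_ge0.
rewrite (partition_big (fun p => symd p.1 p.2) Q) /=; last by move=> p /andP[].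
apply: ler_sum => C QC; have /andP[/andP[CH gC] fC] := QC.
have /set0Pn[x /setIP[xC xB]] := circuit_meets_component closedV cH gH compB CH gC.
have [b bd defB] := compB.
have [D DB /andP[fD xD]] : exists2 D, D \in circuits V B & (f \in D) && (x \in D).
  by move: fB xB; rewrite defB; apply: block_connected.
move: (CH) DB; rewrite !in_circuits => /andP[cC sC] /andP[cD sD].
have CD0 : C :&: D != set0 by apply/set0Pn; exists x; rewrite inE xC.
have [D' [cD' cCD fD' sD']] := theta closedV cC cD fD fC CD0.
have sD'H : D' \subset H by rewrite (subset_trans sD') // subUset sC (subset_trans sD).
have l0' : {in symd C D' :&: D', forall e, l e = 0%N}.
  move=> e /setIP[]; rewrite in_symd => + eD'; rewrite eD' addbT => eC; apply: l0.
  by apply: (subsetP sD); move: (subsetP sD' e eD'); rewrite inE (negPf eC).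
have wC : weight t l C = weight t l D' * weight t l (symd C D').
  by rewrite mulrC /weight -exprD -(sum_symd l0') symdC [symd C _]symdC symdKl.
have CDH : symd C D' \in circuits V H by rewrite in_circuits cCD symd_sub.
have D'H : D' \in circuits V H by rewrite in_circuits cD'.
have eqC : symd D' (symd C D') = C by rewrite [symd C _]symdC symdKl.
have fCD : f \in symd C D' by rewrite in_symd fD' (negPf fC).
have gCD : (g \in symd C D') = (g \notin D') by rewrite in_symd gC.
case: (boolP (g \in D')) => gD'.
  rewrite (bigD1 (D', symd C D')) /=; last first.
    by rewrite /P /Q /= eqC CH gC fC eqxx CDH D'H fD' gD' fCD gCD gD'.
  by rewrite wC lerDl; apply: sumr_ge0 => p _; rewrite mulr_ge0 ?weight_ge0.
rewrite (bigD1 (symd C D', D')) /=; last first.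
  rewrite /P /Q /= [symd (symd _ _) _]symdC eqC CH gC fC eqxx CDH D'H fD'.
  by rewrite (negPf gD') fCD gCD (negPf gD').
by rewrite wC mulrC lerDl; apply: sumr_ge0 => p _; rewrite mulr_ge0 ?weight_ge0.
Qed.

(** Either [f = h] is removable and has positive length, where the inequality is
[0 <= (c - 1) ^+ 2], or [circuit_sum_at_product] applies and the two factors
have sum [c_f + 1]. *)
Lemma circuit_sum_at_square t l H g :
  0 <= t -> connected_set V H -> g \in H -> (4 <= #|members V H|)%N -> (0 < l g)%N ->
  exists f h, [/\ f \in H, h \in H, (0 < l h)%N, connected_set V (del V H f) &
    4 * circuit_sum_at t l H h <= (circuit_sum_at t l H f + 1) ^+ 2].
Proof.
move=> t0 cH gH le4 lg; have [b bd] := del_neq0 cH gH le4.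
have compB : component V H g (block V (del V H g) b) by exists b.
have [f [h [fH hH lh cf fh]]] :=
  @removable_near_marked _ _ closedV (fun e => 0 < l e)%N _ _ _ cH gH lg compB.
exists f, h; split=> //; case: fh => [->|[K [compK fK lK]]].
  rewrite -subr_ge0; set z := circuit_sum_at _ _ _ _.
  by rewrite (_ : _ - _ = (z - 1) ^+ 2) ?sqr_ge0 //; ring.
have lK0 : {in K, forall x, l x = 0%N}.
  by move=> x /lK; rewrite -eqn0Ngt => /eqP.
have := circuit_sum_at_product t0 cH hH compK fK lK0.
rewrite [circuit_sum_at t l H f](bigID (fun C => h \in C)) /=.
under [X in _ -> _ <= (X + _ + _) ^+ 2]eq_bigl do rewrite -andbA.
under [X in _ -> _ <= (_ + X + _) ^+ 2]eq_bigl do rewrite -andbA.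
set a := \sum_(_ | _) _; set c := \sum_(_ | _) _; set z := circuit_sum_at _ _ _ _ => le_z.
have := sqr_ge0 (a - (1 + c)); nra.
Qed.

(** Each circuit through [g] gains the factor [t^-1 = 1 + gam]. *)
Lemma circuit_sum_shorten t (gam : R) l H g :
  t * (1 + gam) = 1 -> (0 < l g)%N ->
  circuit_sum t (fun e => l e - (e == g))%N H =
    circuit_sum t l H + gam * circuit_sum_at t l H g.
Proof.
move=> tgam lg.
have pos C : g \in C -> weight t (fun e => l e - (e == g))%N C = (1 + gam) * weight t l C.
  move=> gC; rewrite /weight (bigD1 g) // [in RHS](bigD1 g) //= eqxx.
  rewrite (eq_bigr l); last by move=> e /andP[_ /negPf ->]; rewrite subn0.
  case: (l g) lg => // k _; rewrite subn1 /= addSn exprS mulrA [_ * t]mulrC tgam mul1r //.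
have neg C : g \notin C -> weight t (fun e => l e - (e == g))%N C = weight t l C.
  move=> gC; congr (_ ^+ _); apply: eq_bigr => e eC.
  by case: eqP => [eg|]; rewrite ?subn0 //; rewrite -eg eC in gC.
rewrite (circuit_sum_del _ _ _ g) [in RHS](circuit_sum_del _ _ _ g).
have -> : circuit_sum_at t (fun e => l e - (e == g))%N H g =
    (1 + gam) * circuit_sum_at t l H g.
  by rewrite /circuit_sum_at mulr_sumr; apply: eq_bigr => C /andP[_]; apply: pos.
have -> : circuit_sum t (fun e => l e - (e == g))%N (del V H g) = circuit_sum t l (del V H g).
  by apply: eq_bigr => C; rewrite circuits_del // => /andP[_]; apply: neg.
ring.
Qed.

(** In the induction [x] is the dimension, [a] and [a'] are [1 / (gam * L + 2)] at
total lengths [L] and [L - 1], and [c], [d] are the sums at [h] and [f].  If the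
conclusion fails, the shortening hypothesis forces [c > (x * a) ^+ 2] while the
deletion hypothesis forces [d + 1 < 2 * x * a], against [4 * c <= (d + 1) ^+ 2]. *)
Lemma lower_bound_step (x a a' gam c d z : R) :
  0 <= x -> 0 < a -> 0 < gam -> a' - a = gam * (a * a') -> a <= a' -> 0 <= d ->
  4 * c <= (d + 1) ^+ 2 ->
  x ^+ 2 * a' - x <= z + gam * c ->
  (x - 1) ^+ 2 * a - (x - 1) + d <= z ->
  x ^+ 2 * a - x <= z.
Proof.
move=> x0 a0 gam0 aa' leaa d0 dc h1 h2; rewrite leNgt; apply/negP => h3.
have hc : x ^+ 2 * (a * a') < c.
  rewrite -(ltr_pM2l gam0).
  have -> : gam * (x ^+ 2 * (a * a')) = x ^+ 2 * (a' - a) by rewrite aa'; ring.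
  lra.
have hc2 : (x * a) ^+ 2 < c.
  apply: le_lt_trans hc; rewrite exprMn; apply: ler_wpM2l; first exact: sqr_ge0.
  by rewrite expr2; apply: ler_wpM2l => //; apply: ltW.
have hd : d + 1 <= 2 * (x * a) by nra.
have : (d + 1) ^+ 2 <= (2 * (x * a)) ^+ 2.
  by rewrite ler_sqr ?nnegrE //; nra.
rewrite exprMn; nra.
Qed.

(** Deleting a removable element lowers [m] by 1 and does not raise the total
length; shortening an element lowers the total length alone.  When the total
length is 0, a deletion loses at least [m] circuits by [circuits_through_geq]. *)
Lemma circuit_sum_lower (gam : R) m l H :
  0 < gam -> connected_set V H -> (2 ^ m <= #|members V H|)%N ->
  m%:R ^+ 2 / (gam * (\sum_(e in H) l e)%N%:R + 2) - m%:R <= circuit_sum (1 + gam)^-1 l H.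
Proof.
move=> gam0; set t := (1 + gam)^-1.
have t0 : 0 <= t by rewrite invr_ge0; lra.
have tgam : t * (1 + gam) = 1 by rewrite mulVf //; apply/negP => /eqP; lra.
have den k : 0 < gam * k%:R + 2 :> R by rewrite ltr_wpDl // mulr_ge0 // ltW.
elim: m l H => [|[_|m IH]] l H cH lem.
- by rewrite expr2 !mul0r subr0 circuit_sum_ge0.
- apply: le_trans (circuit_sum_ge0 _ _ t0); rewrite expr1n subr_le0 mul1r invf_le1 //.
  set k := (\sum_(e in H) l e)%N; have : 0 <= gam * k%:R by rewrite mulr_ge0 // ltW.
  lra.
have le4 : (4 <= #|members V H|)%N.
  by apply: leq_trans lem; rewrite -[4%N]/(2 ^ 2)%N leq_exp2l.
have drop k f : f \in H -> connected_set V (del V H f) ->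
    m.+1%:R ^+ 2 / (gam * (\sum_(e in H) k e)%N%:R + 2) - m.+1%:R
      + circuit_sum_at t k H f <= circuit_sum t k H.
  move=> fH cf; rewrite (circuit_sum_del _ _ _ f) addrC lerD2l.
  apply: le_trans (IH k _ cf _); last first.
    by rewrite -(leq_pmul2l (ltn0Sn 1)) -expnS (leq_trans lem) // members_half.
  rewrite lerD2r ler_wpM2l ?exprn_ge0 // lef_pV2 ?posrE // lerD2r ler_wpM2l ?(ltW gam0) //.
  rewrite ler_nat [leqRHS](big_setID (del V H f)) /= (setIidPr (del_sub _ _ _)).
  exact: leq_addr.
move defn: (\sum_(e in H) l e)%N => n.
elim: n l defn => [|n IHn] l defn.
  have [f0 f0H] : exists f, f \in H.
    by apply: exists_in_members; apply: leq_trans le4.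
  have [b bd] := del_neq0 cH f0H le4.
  have compB : component V H f0 (block V (del V H f0) b) by exists b.
  have [f fB cf] := removable_in_component closedV cH f0H compB.
  have fH : f \in H by apply: (subsetP (component_sub compB)).
  apply: le_trans (drop l f fH cf); rewrite defn mulr0 add0r.
  have : m.+2%:R <= circuit_sum_at t l H f.
    have -> : circuit_sum_at t l H f = #|[set C in circuits V H | f \in C]|%:R.
      rewrite /circuit_sum_at -sum1_card natr_sum.
      apply: eq_big => [C|C /andP[]]; first by rewrite in_set.
      rewrite in_circuits => /andP[_ sC] _.
      suff s0 : (\sum_(e in C) l e = 0)%N by rewrite /weight s0.
      apply/eqP; rewrite -leqn0 -[leqRHS]defn [leqRHS](big_setID C) /= (setIidPr sC).
      exact: leq_addr.
    by rewrite ler_nat circuits_through_geq.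
  rewrite -[m.+2]addn1 natrD; set x := m.+1%:R; lra.
have [g gH lg] : exists2 g, g \in H & (0 < l g)%N.
  apply/exists_inP; apply: contraT => /exists_inPn l0.
  by move: defn; rewrite big1 // => e /l0; rewrite -eqn0Ngt => /eqP.
have [f [h [fH hH lh cf hfh]]] := circuit_sum_at_square t0 cH gH le4 lg.
pose l' e := (l e - (e == h))%N.
have defn' : (\sum_(e in H) l' e = n)%N.
  apply/eqP; rewrite -(eqn_add2l 1) [X in _ == X](_ : _ = n.+1) // -defn.
  rewrite (bigD1 h) //= [X in _ == X](bigD1 h) //= /l' eqxx addnA subnKC //.
  by apply/eqP; congr (_ + _)%N; apply: eq_bigr => e /andP[_ /negPf->]; rewrite subn0.
set a := (gam * n.+1%:R + 2)^-1; set a' := (gam * n%:R + 2)^-1.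
have ga : gam * n.+1%:R + 2 != 0 by rewrite gt_eqF.
have ga' : gam * n%:R + 2 != 0 by rewrite gt_eqF.
apply: (@lower_bound_step m.+2%:R a a' gam
  (circuit_sum_at t l H h) (circuit_sum_at t l H f)) => //.
- by rewrite invr_gt0.
- by rewrite /a /a' -natr1 in ga *; field; rewrite ga'.
- by rewrite /a /a' lef_pV2 ?posrE // lerD2r ler_wpM2l ?(ltW gam0) // ler_nat.
- exact: circuit_sum_at_ge0.
- by rewrite -circuit_sum_shorten //; apply: IHn.
have := drop l f fH cf; rewrite defn -/a.
by rewrite (_ : m.+2%:R - 1 = m.+1%:R) // -[m.+2]addn1 natrD addrK.
Qed.

End Weights.

(** * Circuits of distinct sizes *)

Section DistinctSizes.
Local Open Scope ring_scope.

Lemma geometric_bound (R : realFieldType) (gam : R) k :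
  0 < gam -> \sum_(i < k) (1 + gam)^-1 ^+ i.+1 <= gam^-1.
Proof.
move=> gam0; set t := _^-1; have t0 : 0 <= t by rewrite invr_ge0; lra.
have g1 : 1 + gam != 0 by apply/negP => /eqP; lra.
have g0 : gam != 0 by rewrite gt_eqF.
have -> : \sum_(i < k) t ^+ i.+1 = (1 - t ^+ k) / gam.
  elim: k => [|k IH]; first by rewrite big_ord0 subrr mul0r.
  rewrite big_ord_recr /= IH exprS; set u := t ^+ k; rewrite /t; field.
  by rewrite g0 g1.
by rewrite -[leRHS]mul1r ler_wpM2r ?invr_ge0 ?(ltW gam0) // gerBl exprn_ge0.
Qed.

Lemma nullity_bound (R : realFieldType) (E : finType) (V : {set {set E}}) H m (gam : R) :
  symd_closed V -> connected_set V H -> (2 ^ m <= #|members V H|)%N ->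
  {in circuits V H &, injective (fun C : {set E} => #|C|)} -> 0 < gam ->
  m%:R ^+ 2 <= (gam * #|H|%:R + 2) * (gam^-1 + m%:R).
Proof.
move=> closedV cH lem injC gam0; have := circuit_sum_lower closedV (fun=> 1%N) gam0 cH lem.
rewrite sum1_card; set h : R := #|H|%:R.
have h0 : 0 <= gam * h by rewrite mulr_ge0 // ltW.
have : circuit_sum V (1 + gam)^-1 (fun=> 1%N) H <= gam^-1.
  pose pr (C : {set E}) : 'I_#|H|.+1 := inord #|C|.-1.
  have posC C : C \in circuits V H -> (0 < #|C| <= #|H|)%N.
    rewrite in_circuits => /andP[/circuitP[_ C0 _] sC].
    by rewrite card_gt0 C0 subset_leq_card.
  have prE C : C \in circuits V H -> (pr C).+1 = #|C|.
    move=> /posC/andP[C0 leC]; rewrite inordK ?prednK //.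
    by apply: leq_trans leC _.
  have injp : {in circuits V H &, injective pr}.
    by move=> C D CH DH /(congr1 (fun i : 'I_ _ => i.+1)); rewrite !prE //; apply: injC.
  apply: le_trans (geometric_bound #|H|.+1 gam0).
  have -> : circuit_sum V (1 + gam)^-1 (fun=> 1%N) H =
      \sum_(i in pr @: circuits V H) (1 + gam)^-1 ^+ i.+1.
    rewrite big_imset //=; apply: eq_bigr => C CH.
    by rewrite prE // /weight sum1_card.
  rewrite [leRHS](bigID (fun i => i \in pr @: circuits V H)) /= lerDl.
  by apply: sumr_ge0 => i _; rewrite exprn_ge0 // invr_ge0; lra.
move=> Zup Zlow; rewrite mulrC -ler_pdivrMr; last by lra.
lra.
Qed.

(** With [s = sqrt n], [d = eps / 2], [gam = d / s] and [m > (1 + 2 * d) * s], the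
hypothesis divided by [m] gives [m <= s + d * s + K + (d / s) * m], which bounds
[s] by the constant [T] below. *)
Lemma edge_bound_of_nullity_bound (R : realType) (eps : R) : 0 < eps ->
  exists n0 : nat, forall n e m : nat, (n0 <= n)%N -> m = (e - n.-1)%N ->
   (forall gam : R, 0 < gam -> m%:R ^+ 2 <= (gam * e%:R + 2) * (gam^-1 + m%:R)) ->
   e%:R <= n%:R + (1 + eps) * Num.sqrt (n%:R : R).
Proof.
move=> eps0; pose d := eps / 2; have d0 : 0 < d by rewrite divr_gt0.
(* K collects the terms of bounded order after the division by m, using s <= m. *)
pose K := 3 + 2 / d; pose T := K / d + 1 + 2 * d.
have K0 : 0 < K by rewrite addr_gt0 ?divr_gt0.
have T0 : 1 <= T by have := divr_gt0 K0 d0; rewrite /T; lra.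
exists (Num.bound (T ^+ 2)) => n e m len -> bnd; rewrite leNgt; apply/negP.
set s := Num.sqrt _ => lt_e.
have sn : s ^+ 2 = n%:R by rewrite sqr_sqrtr ?ler0n.
have sT : T < s.
  have : T ^+ 2 < s ^+ 2.
    rewrite sn; apply: lt_le_trans (archi_boundP (sqr_ge0 T)) _; by rewrite ler_nat.
  by rewrite ltr_sqr // nnegrE ?sqrtr_ge0 //; lra.
have s0 : 0 < s by lra.
have ltne : (n < e)%N.
  by rewrite -(ltr_nat R); apply: lt_trans lt_e; rewrite ltrDl mulr_gt0 //; lra.
have n0 : (0 < n)%N by rewrite -(ltr_nat R) -sn exprn_gt0.
have me : (e - n.-1)%:R = e%:R - n%:R + 1 :> R.
  rewrite natrB; last by apply: leq_trans (leq_pred n) (ltnW ltne).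
  by rewrite -[in RHS](prednK n0) -natr1; ring.
pose x : R := (e - n.-1)%:R.
have ex : e%:R = s ^+ 2 + x - 1 by rewrite /x me sn; ring.
have xs : (1 + 2 * d) * s <= x.
  have -> : 1 + 2 * d = 1 + eps by rewrite /d; field.
  by rewrite /x me; lra.
have sx : s <= x by nra.
have x0 : 0 < x by lra.
have s_neq0 : s != 0 by rewrite gt_eqF.
have d_neq0 : d != 0 by rewrite gt_eqF.
pose r := d / s; have r0 : 0 < r by rewrite divr_gt0.
have rs : r * s = d by rewrite /r; field.
have di0 : 0 < d^-1 by rewrite invr_gt0.
have sd : s * d^-1 <= x * d^-1 by rewrite ler_pM2r.
have := bnd r r0; rewrite -/x ex => bx.
have : x ^+ 2 <= s ^+ 2 + 3 * x + d * s * x + r * x ^+ 2 + 2 * (s * d^-1).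
  apply: le_trans bx _.
  have -> : (r * (s ^+ 2 + x - 1) + 2) * (r^-1 + x) =
      s ^+ 2 + 3 * x + d * s * x + r * x ^+ 2 + 2 * (s * d^-1) - (1 + r * x).
    by rewrite /r; field; rewrite s_neq0 d_neq0.
  by rewrite gerBl; nra.
have ss : s ^+ 2 <= s * x by rewrite expr2 ler_pM2l.
move=> bx2; have : x * x <= x * (s + K + d * s + r * x).
  by rewrite /K; nra.
rewrite ler_pM2l // => bx3.
have r1 : r < 1.
  rewrite -(ltr_pM2r s0) rs mul1r; apply: lt_trans sT; rewrite /T.
  by have := divr_gt0 K0 d0; lra.
have : (1 - r) * ((1 + 2 * d) * s) <= (1 - r) * x by rewrite ler_pM2l //; lra.
have -> : (1 - r) * ((1 + 2 * d) * s) = (1 + 2 * d) * (s - r * s) by ring.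
rewrite rs => bx4.
have : d * s <= d * T.
  have -> : d * T = K + d + 2 * d ^+ 2 by rewrite /T; field.
  lra.
by rewrite ler_pM2l // leNgt sT.
Qed.

End DistinctSizes.

(** * Even edge sets of a graph *)

Lemma odd_symd (T : finType) (A B : {set T}) : odd #|symd A B| = odd #|A| (+) odd #|B|.
Proof.
have -> : #|symd A B| = #|A :\: B| + #|B :\: A|.
  rewrite /symd cardsU [_ :&: _](_ : _ = set0) ?cards0 ?subn0 //.
  by apply/setP=> x; rewrite !inE; case: (x \in A); case: (x \in B).
rewrite -(cardsID B A) -[#|B|](cardsID A B) setIC !oddD.
by case: (odd _); case: (odd _); case: (odd _).
Qed.

Section EvenSets.

Variable G : sgraph.
Implicit Types (D A : {set {set G}}) (x y u v w : G).

Definition star (D : {set {set G}}) (v : G) : {set {set G}} := [set e in D | v \in e].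

Definition boundary (D : {set {set G}}) : {set G} := [set v | odd #|star D v|].

Definition even_sets : {set {set {set G}}} :=
  [set D : {set {set G}} | (D \subset edges G) && (boundary D == set0)].

Lemma edgeP (e : {set G}) :
  reflect (exists x y, [/\ x != y, adj x y & e = [set x; y]]) (e \in edges G).
Proof.
apply: (iffP imset2P) => [[x y _]|[x [y [_ xy ->]]]].
  rewrite inE => /andP[_ xy] ->; exists x, y; split=> //.
  by apply: contraTneq xy => ->; rewrite adj_irr.
by exists x y; rewrite // inE.
Qed.

Lemma edge_adj x y : adj x y -> [set x; y] \in edges G.
Proof.
move=> xy; apply/edgeP; exists x, y; split=> //.
by apply: contraTneq xy => ->; rewrite adj_irr.
Qed.

Lemma pair_eq x y u v : [set x; y] = [set u; v] ->
  (x = u /\ y = v) \/ (x = v /\ y = u).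
Proof.
move=> E; have := set21 x y; have := set22 x y; have := set21 u v; have := set22 u v.
rewrite {1 2}E -{1 2}E !inE.
case/orP=> /eqP ? /orP[] /eqP ? /orP[] /eqP ? /orP[] /eqP ?; subst; auto.
Qed.

Lemma edge_adjE x y : ([set x; y] \in edges G) = adj x y.
Proof.
apply/idP/idP => [/edgeP[u [v [_ uv /pair_eq[] [-> ->] //]]]|]; last exact: edge_adj.
by rewrite adj_sym.
Qed.

Lemma star_symd A D v : star (symd A D) v = symd (star A v) (star D v).
Proof.
apply/setP=> e; rewrite inE !in_symd !inE.
by case: (v \in e); rewrite ?andbF ?andbT.
Qed.

Lemma boundary_symd A D : boundary (symd A D) = symd (boundary A) (boundary D).
Proof. by apply/setP=> v; rewrite inE star_symd odd_symd in_symd !inE. Qed.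

Lemma boundary0 : boundary set0 = set0.
Proof.
apply/setP=> v; rewrite !inE (_ : star _ _ = set0) ?cards0 //.
by apply/setP=> e; rewrite !inE.
Qed.

Lemma boundary1 e : boundary [set e] = e.
Proof.
apply/setP=> v; rewrite inE; case: (boolP (v \in e)) => ve.
  by rewrite (_ : star _ _ = [set e]) ?cards1 //; apply/setP => f; rewrite !inE;
     case: eqP => //= ->.
rewrite (_ : star _ _ = set0) ?cards0 //; apply/setP => f; rewrite !inE.
by case: eqP => //= ->; rewrite (negPf ve).
Qed.

Lemma even_sets_closed : symd_closed even_sets.
Proof.
split; first by rewrite inE sub0set boundary0 eqxx.
move=> A D; rewrite !inE boundary_symd => /andP[sA /eqP->] /andP[sD /eqP->].
by rewrite symd_sub //=; apply/eqP/setP=> v; rewrite in_symd addbb inE.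
Qed.

(** The boundary is linear and the boundary of a single edge consists of its two
ends. *)
Lemma handshake (D : {set {set G}}) : D \subset edges G -> ~~ odd #|boundary D|.
Proof.
have [n] := ubnP #|D|; elim: n D => // n IH D leD sD.
have [->|/set0Pn[e eD]] := eqVneq D set0; first by rewrite boundary0 cards0.
have -> : D = symd [set e] (D :\ e).
  apply/setP=> f; rewrite in_symd !inE; case: eqP => [->|] //=.
rewrite boundary_symd odd_symd boundary1.
have [x [y [xy _ defe]]] := edgeP _ (subsetP sD e eD).
rewrite {1}defe cards2 xy /= IH // ?(subset_trans (subsetDl _ _)) //.
by rewrite ltnS in leD; apply: leq_trans leD; rewrite [X in _ < X](cardsD1 e) eD.
Qed.

(** An even set is determined by its part outside one fixed point. *)
Lemma card_even_subsets (T : finType) (v0 : T) :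
  #|[set X : {set T} | ~~ odd #|X|]| <= 2 ^ #|T|.-1.
Proof.
rewrite -(cardsC1 v0) -card_powerset -(@card_in_imset _ _ (fun X => X :\ v0)).
  apply/subset_leq_card/subsetP => _ /imsetP[X _ ->]; rewrite powersetE.
  by apply/subsetP => x; rewrite !inE => /andP[].
move=> X Y; rewrite !inE => oX oY eXY; apply: symd_eq0.
have sub : symd X Y \subset [set v0].
  apply/subsetP=> x; rewrite in_symd !inE; move/setP/(_ x): eXY; rewrite !inE.
  by case: eqP => //= _ ->; rewrite addbb.
have := odd_symd X Y; rewrite (negPf oX) (negPf oY).
by move: sub; rewrite subset1 => /orP[] /eqP ->; rewrite ?cards1.
Qed.

(** Rank-nullity, by counting: the boundary map takes at most [2 ^ (n - 1)] values by
[handshake], and each fibre is a coset of the space of even sets. *)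
Lemma card_even_sets : 0 < #|G| -> 2 ^ (#|edges G| - #|G|.-1) <= #|even_sets|.
Proof.
case/card_gt0P=> v0 _; case: (leqP #|edges G| #|G|.-1) => [|/ltnW lt].
  rewrite -subn_eq0 => /eqP ->; apply/card_gt0P; exists set0; exact: even_sets_closed.1.
rewrite -(@leq_pmul2l (2 ^ #|G|.-1)) ?expn_gt0 // -expnD subnKC // -card_powerset.
apply: leq_trans (leq_mul (card_even_subsets v0) (leqnn _)).
rewrite -sum_nat_const -sum1_card.
rewrite (partition_big boundary (fun X => X \in [set X : {set G} | ~~ odd #|X|])) /=.
  apply: leq_sum => X _; rewrite sum1_card -cardsE.
  set F := [set _ | _]; have [->|/set0Pn[D0 D0F]] := eqVneq F set0; first by rewrite cards0.
  rewrite -(card_imset _ (can_inj (symdKl D0))) subset_leq_card //.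
  apply/subsetP => _ /imsetP[D + ->]; move: D0F; rewrite !inE.
  move=> /andP[sD0 /eqP bD0] /andP[sD /eqP bD]; rewrite !powersetE in sD0 sD.
  rewrite symd_sub //= boundary_symd bD bD0.
  by apply/eqP/setP=> v; rewrite in_symd addbb inE.
by move=> D; rewrite powersetE inE; apply: handshake.
Qed.

(** The two edges at [v] differ because a simple cycle of length at least 3 does not
return to [v] after two steps. *)
Lemma star_cycle (c : seq G) v : uniq c -> 2 < size c -> v \in c ->
  [set v; next c v] != [set prev c v; v] /\
  star (cycle_edges c) v = [set [set v; next c v]; [set prev c v; v]].
Proof.
move=> Uc c3 vc; split.
  apply/eqP => /pair_eq[[_ E]|[_ E]].
    case/rot_to: vc => i s' rE; move: E; rewrite -(next_rot i Uc) rE.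
    have: uniq (rot i c) by rewrite rot_uniq.
    have: size (rot i c) = size c by rewrite size_rot.
    rewrite rE; case: s' {rE} => [|a [|b s']] /= sz; try by rewrite -sz in c3.
    by rewrite eqxx !inE => /andP[] + _ E; rewrite E eqxx.
  have : next c (next c v) = v by rewrite E next_prev.
  case/rot_to: vc => i s' rE; rewrite -!(next_rot i Uc) rE.
  have: uniq (rot i c) by rewrite rot_uniq.
  have: size (rot i c) = size c by rewrite size_rot.
  rewrite rE; case: s' {rE} => [|a [|b s']] /= sz; try by rewrite -sz in c3.
  rewrite eqxx !inE !negb_or => /andP[/and3P[va vb _] _].
  by rewrite eq_sym (negPf va) eqxx => /eqP; rewrite eq_sym (negPf vb).
apply/setP => e; rewrite !inE; apply/andP/orP => [[/imsetP[x xc ->]]|].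
  by rewrite !inE => /orP[] /eqP ->; [left|right; rewrite prev_next].
case=> /eqP->; rewrite !inE eqxx ?orbT; split=> //; apply/imsetP; first by exists v.
by exists (prev c v); rewrite ?mem_prev // next_prev.
Qed.

Lemma cycle_even (c : seq G) : ucycle (@adj G) c -> 2 < size c -> cycle_edges c \in even_sets.
Proof.
case/andP=> cc Uc c3; rewrite inE; apply/andP; split.
  by apply/subsetP=> _ /imsetP[x xc ->]; rewrite edge_adjE next_cycle.
apply/eqP/setP=> v; rewrite !inE; apply/negP.
have [vc|vc] := boolP (v \in c).
  by have [ne ->] := star_cycle Uc c3 vc; rewrite cards2 ne.
rewrite (_ : star _ _ = set0) ?cards0 //; apply/setP=> e; rewrite !inE.
apply/negP => /andP[/imsetP[x xc ->]]; rewrite !inE => /orP[] /eqP E.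
  by rewrite E xc in vc.
by rewrite E mem_next xc in vc.
Qed.

(** Removing an edge [xy] from an even set leaves [x] and [y] connected: otherwise
the remaining edges in the component of [y] would have [y] as their only vertex of
odd degree, against [handshake].  The resulting cycle is an even subset of the
circuit, hence all of it. *)
Lemma circuit_is_cycle D : circuit even_sets D -> is_cycle D.
Proof.
case/circuitP; rewrite inE => /andP[sD /eqP bD] /set0Pn[e eD] minD.
have [x [y [xy axy defe]]] := edgeP _ (subsetP sD e eD).
pose D' := D :\ e; pose r u w := [set u; w] \in D'.
have sD' : D' \subset edges G by apply: subset_trans sD; apply: subsetDl.
have bD' : boundary D' = e.
  rewrite /D' -symdD ?sub1set // boundary_symd bD boundary1.
  by apply/setP=> v; rewrite in_symd inE addFb.
have r_adj u w : r u w -> adj u w by move=> ruw; rewrite -edge_adjE (subsetP sD').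
have yx : connect r y x.
  apply: contraT => nyx; pose S := [set w | connect r y w].
  pose D'' := [set f in D' | f \subset S].
  have sD'' : D'' \subset edges G.
    by apply: subset_trans sD'; apply/subsetP=> f; rewrite inE => /andP[].
  suff bD'' : boundary D'' = [set y] by have := handshake sD''; rewrite bD'' cards1.
  apply/setP=> v; have [vS|vS] := boolP (v \in S).
    have -> : (v \in boundary D'') = (v \in boundary D').
      rewrite [LHS]in_set [RHS]in_set; congr (odd #|pred_of_set _|); apply/setP=> f.
      rewrite [LHS]in_set [RHS]in_set [f \in D'']in_set.
      case: (boolP (v \in f)); rewrite ?andbF // !andbT => vf.
      case: (boolP (f \in D')) => //= fD.
      have [a [b [_ ab def]]] := edgeP _ (subsetP sD' f fD).
      move: vS vf; rewrite !inE def => yv vf; rewrite subUset !sub1set !inE.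
      have rab : r a b by rewrite /r -def.
      have rba : r b a by rewrite /r setUC -def.
      move: vf; rewrite !inE => /orP[] /eqP E; subst v.
        by rewrite yv (connect_trans yv) ?connect1.
      by rewrite yv (connect_trans yv) ?connect1.
    rewrite bD' defe !inE; case: eqP vS => // ->.
    by rewrite inE (negPf nyx).
  have -> : (v \in boundary D'') = false.
    rewrite inE (_ : star _ _ = set0) ?cards0 //; apply/setP=> f; rewrite !inE.
    by apply/negP=> /andP[/andP[_ /subsetP sf] /sf]; apply/negP.
  by rewrite inE; apply/esym/negP => /eqP E; rewrite E inE connect0 in vS.
case/connectP: yx => p0 /shortenP[p pathp Up _] lastp.
have cc : cycle (@adj G) (y :: p).
  by rewrite /= rcons_path (sub_path r_adj) // -lastp axy.
have p2 : 1 < size p.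
  case: p pathp Up lastp {cc} => [_ _ /= E|a [|]] //=; first by rewrite E eqxx in xy.
  by rewrite andbT => + _ E; rewrite -E /r /D' defe setUC !inE eqxx.
exists (y :: p); split=> //; first by rewrite /ucycle cc.
apply/esym/minD; first by apply: cycle_even => //; rewrite /ucycle cc.
  apply/subsetP => _ /imsetP[u uc ->].
  have cr : cycle (fun u w => [set u; w] \in D) (y :: p).
    rewrite /= rcons_path -lastp -defe eD andbT.
    by apply: sub_path pathp => a b; rewrite /r inE => /andP[].
  exact: next_cycle cr uc.
by apply/set0Pn; exists [set y; next (y :: p) y]; apply: imset_f; rewrite inE eqxx.
Qed.

(** * Two-connected graphs *)

Hypothesis G2 : k_connected 2 G.

Lemma connect_adj x y : connect (@adj G) x y.
Proof.
have [_ /(_ set0)] := G2; rewrite cards0 => /(_ isT)[_ /(_ x y)].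
rewrite !inE => /(_ isT isT); apply: connect_sub => u v /and3P[_ _ uv]; exact: connect1.
Qed.

(** Otherwise the property that all edges at a vertex belong to [A] would spread
along the connected graph from an end of an edge of [A] to every vertex. *)
Lemma mixed_vertex A : A \subset edges G -> A != set0 -> A != edges G ->
  exists v a b, [/\ adj v a, adj v b, [set v; a] \in A & [set v; b] \notin A].
Proof.
move=> sA /set0Pn[f fA] AG.
have [/existsP[v /existsP[a /existsP[b /and4P[? ? ? ?]]]]|none] :=
  boolP [exists v, exists a, exists b,
    [&& adj v a, adj v b, [set v; a] \in A & [set v; b] \notin A]].
  by exists v, a, b.
have pure v a b : adj v a -> [set v; a] \in A -> adj v b -> [set v; b] \in A.
  move=> va vaA vb; apply: contraNT none => vbA.
  by apply/existsP; exists v; apply/existsP; exists a; apply/existsP; exists b; apply/and4P.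
have [x [y [_ xy deff]]] := edgeP _ (subsetP sA f fA).
have xyA : [set x; y] \in A by rewrite -deff.
case/negP: AG; rewrite eqEsubset sA; apply/subsetP=> _ /edgeP[u [w [_ uw ->]]].
have /connectP[p pp lastp] := connect_adj x u.
elim: p x y xy xyA pp lastp {f fA deff} => [|z p IH] x y xy xyA /=.
  by move=> _ uE; rewrite uE in uw *; apply: pure xyA uw.
case/andP=> xz pz lastp; apply: (IH z x) => //; first by rewrite adj_sym.
by rewrite setUC; apply: pure xyA xz.
Qed.

(** At a vertex [v] with neighbours [a], [b] such that [va] is in [A] and [vb] is
not, a path from [a] to [b] that avoids [v] closes to a cycle with exactly one edge
of [A] at [v]. *)
Lemma not_separator A : A \subset edges G -> A != set0 -> A != edges G ->
  exists2 D, D \in even_sets & D :&: A \notin even_sets.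
Proof.
move=> sA A0 AG; have [v [a [b [va vb vaA vbA]]]] := mixed_vertex sA A0 AG.
have [_ /(_ [set v])] := G2; rewrite cards1 => /(_ isT)[_ /(_ a b)].
rewrite !inE; have av : a != v by apply: contraTneq va => ->; rewrite adj_irr.
have bv : b != v by apply: contraTneq vb => ->; rewrite adj_irr.
move=> /(_ av bv)/connectP[p0 /shortenP[p pathp Up _] lastp].
pose c := v :: a :: p.
have pathc : path (@adj G) a p by apply: sub_path pathp => u w /and3P[].
have vp : v \notin p.
  apply/negP => vp; case/splitPr: vp pathp => p1 p2; rewrite cat_path /= => /and3P[_ + _].
  by case/and3P; rewrite !inE eqxx.
have Uc : uniq c by rewrite /c cons_uniq Up andbT inE negb_or eq_sym av vp.
have ab : a != b by apply: contraNneq vbA => <-.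
have c3 : 2 < size c.
  by case: p {pathp Up pathc vp Uc} @c lastp => [/= E|//]; rewrite E eqxx in ab.
have vc : v \in c by rewrite inE eqxx.
have cc : ucycle (@adj G) c.
  by rewrite /ucycle Uc andbT /= va rcons_path pathc -lastp adj_sym vb.
have nv : next c v = a by rewrite /= eqxx.
have bc : b \in c by rewrite /c lastp inE mem_last orbT.
have nb : next c b = v.
  have idx : index b c = (size p).+1 by rewrite lastp; apply: (@index_last _ v (a :: p)).
  by rewrite next_nth bc idx; apply: nth_default.
have pv : prev c v = b by rewrite -nb prev_next.
exists (cycle_edges c); first exact: cycle_even.
rewrite inE negb_and; apply/orP; right; apply/set0Pn; exists v; rewrite inE.
have [_ sE] := star_cycle Uc c3 vc.
rewrite (_ : star _ _ = [set [set v; a]]) ?cards1 //.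
rewrite nv pv in sE; apply/setP => e.
rewrite inE [in LHS]inE -andbA [_ && (v \in e)]andbC andbA.
move/setP/(_ e): sE; rewrite inE => ->; rewrite !inE.
case: eqP => [->|_]; first by rewrite vaA.
by case: eqP => //= ->; rewrite setUC (negPf vbA).
Qed.

(** An edge on no circuit would be a separator of the even sets by itself.  For an
edge on a circuit, the set of all edges that share a circuit with it is a
separator, hence everything. *)
Lemma edges_connected_set : connected_set even_sets (edges G).
Proof.
move=> f g fG gG.
have fin : f \in block even_sets (edges G) f.
  have [|||D DE] := @not_separator [set f]; rewrite ?sub1set //.
  - by apply/set0Pn; exists f; rewrite inE.
  - apply/negP => /eqP E; have [x [y [xy _ deff]]] := edgeP _ fG.
    have [gt2 _] := G2.
    have /subsetPn[z _ zf] : ~~ ([set: G] \subset f).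
      apply/negP => /subset_leq_card; rewrite cardsT deff cards2 xy; by rewrite leqNgt gt2.
    have /connectP[[|w p]] := connect_adj z x.
      by move=> _ /= E'; rewrite deff E' !inE eqxx in zf.
    move=> /= /andP[zw _] _; have := edge_adj zw; rewrite -E inE => /eqP E'.
    by rewrite -E' !inE eqxx in zf.
  have [fD _|fD] := boolP (f \in D).
    have [C] := circuit_through even_sets_closed DE fD; rewrite in_circuits => /andP[cC sC] fC.
    apply/blockP; exists C; rewrite in_circuits cC (subset_trans sC) //.
    by move: DE; rewrite inE => /andP[].
  case/negP; rewrite (_ : _ :&: _ = set0) ?even_sets_closed.1 //.
  by apply/setP=> e; rewrite !inE; case: eqP => [->|]; rewrite ?(negPf fD) ?andbF.
suff /blockP[C [CH fC gC]] : g \in block even_sets (edges G) f by exists C; rewrite ?fC.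
suff -> : block even_sets (edges G) f = edges G by [].
apply/eqP; apply: contraT => ne.
have [|||D DE /negP[]] := @not_separator (block even_sets (edges G) f).
- exact: block_sub.
- by apply/set0Pn; exists f.
- exact: ne.
apply: (@member_split _ _ even_sets_closed (edges G)) => [C CH /set0Pn[x /setIP[xC xf]]|].
  exact: (block_circuit even_sets_closed CH xC xf).
by rewrite inE DE; move: DE; rewrite inE => /andP[].
Qed.

End EvenSets.

Local Open Scope ring_scope.

Theorem theorem1p2 (R : realType) (eps : R) (eps_gt0 : 0 < eps) :
  exists n0 : nat, forall n : nat, (n0 <= n)%N ->
    forall G : sgraph, #|G| = n -> k_connected 2 G ->
      distinct_cycle_lengths G ->
      #|edges G|%:R <= n%:R + (1 + eps) * Num.sqrt (n%:R : R).
Proof.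
have [n0 bnd] := edge_bound_of_nullity_bound eps_gt0.
exists n0 => n len G cardG G2 dist; apply: bnd len erefl _ => gam gam0.
have cG := edges_connected_set G2; have closedV := even_sets_closed G.
have memE : members (even_sets G) (edges G) = even_sets G.
  by apply/setP=> D; rewrite !inE andbC andbA andbb.
have G0 : (0 < #|G|)%N by have [+ _] := G2; apply: leq_trans.
apply: (nullity_bound closedV cG) => //; first by rewrite memE -cardG; apply: card_even_sets.
move=> C D; rewrite !in_circuits.
move=> /andP[/circuit_is_cycle cC _] /andP[/circuit_is_cycle cD _] eqCD.
by apply/eqP; apply: contraT => /eqP /(dist C D cC cD).
Qed.
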